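(* Let $\gamma,\gamma'>0$ be such that $\gamma'<\gamma$. Let $E$ and $F$ be two normed vector spaces and $U$ be a subset of $E$. Assume that $(E^{\otimes k})_{1\leq k\leq\lfloor\gamma\rfloor}$ are endowed with norms satisfying the projective property. Let $f:U\to F$ be a $\mathrm{Lip}-\gamma$ map. Then $f$ is $\mathrm{Lip}-\gamma'$ and there exists a constant $M_{\gamma,\gamma'}$ (depending only on $\gamma$ and $\gamma'$) such that $$\|f\|_{\mathrm{Lip}-\gamma'}\leq M_{\gamma,\gamma'}\|f\|_{\mathrm{Lip}-\gamma}.$$
   Context: Notation. For a real number $\gamma>0$, $\lfloor\gamma\rfloor$ denotes the unique integer with $0<\gamma-\lfloor\gamma\rfloor\leq1$ (so $\lfloor\gamma\rfloor=\gamma-1$ when $\gamma$ is an integer). $E^{\otimes k}$ is the $k$-fold algebraic tensor power of $E$, with a fixed norm also denoted $\|\cdot\|$. $\mathcal{L}_s(E^{\otimes k},F)$ is the space of symmetric $k$-linear mappings from $E$ to $F$, seen as linear maps on $E^{\otimes k}$. Lipschitz maps. Let $n\geq0$ be an integer, $0<\varepsilon\leq1$, $U\subseteq E$ any subset, $f^0:U\to F$ and $f^k:U\to\mathcal{L}_s(E^{\otimes k},F)$ for $1\leq k\leq n$. The remainder of order $k$ ($0\leq k\leq n$) of $f=(f^0,\dots,f^n)$ is defined by $$f^k(x)(v)=\sum_{j=k}^n f^j(y)\Big(\frac{v\otimes(x-y)^{\otimes(j-k)}}{(j-k)!}\Big)+R_k(x,y)(v),\quad x,y\in U,\ v\in E^{\otimes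 k}.$$ $f$ is $\mathrm{Lip}-(n+\varepsilon)$ on $U$ if there is $M$ such that for all $0\leq k\leq n$, $x,y\in U$, $v_1,\dots,v_k\in E$: $\|f^k(x)(v_1\otimes\cdots\otimes v_k)\|\leq M\|v_1\otimes\cdots\otimes v_k\|$ and $\|R_k(x,y)(v_1\otimes\cdots\otimes v_k)\|\leq M\|x-y\|^{n+\varepsilon-k}\|v_1\otimes\cdots\otimes v_k\|$. The smallest such $M$ is $\|f\|_{\mathrm{Lip}-(n+\varepsilon)}$. One often says that $f^0$ is Lip, the maps $f^1,\dots,f^n$ being understood. When a $\mathrm{Lip}-\gamma$ map $f=(f^0,\dots,f^{\lfloor\gamma\rfloor})$ is considered at a lower degree $\gamma'<\gamma$, it is understood as the truncated collection $(f^0,\dots,f^{\lfloor\gamma'\rfloor})$ (with the remainders recomputed for that collection). Projective property. The norms on $(E^{\otimes k})_{1\leq k\leq n}$ satisfy the projective property if $\|a\otimes b\|\leq\|a\|\|b\|$ for all $a\in E^{\otimes p}$, $b\in E^{\otimes q}$ with $p+q\leq n$. *)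

(* Defs.v *)
From HB Require Import structures.
From mathcomp Require Import all_boot all_order all_algebra.
From mathcomp Require Import perm generic_quotient ring_quotient freeg.
From mathcomp Require Import all_classical all_reals all_analysis.

Set Implicit Arguments.
Unset Strict Implicit.
Unset Printing Implicit Defensive.

Import Order.TTheory GRing.Theory Num.Theory.
Import numFieldNormedType.Exports.

Local Open Scope classical_set_scope.
Local Open Scope ring_scope.
Local Open Scope quotient_scope.

(** Algebraic tensor powers: the free module on [k.-tuple E], modulo the
    submodule generated by the multilinearity relations. *)

Definition tset (E : Type) k (v : k.-tuple E) (i : 'I_k) (x : E) : k.-tuple E :=
  [tuple if j == i then x else tnth v j | j < k].

Definition multilinear (R : realType) (E G : lmodType R) k
    (g : k.-tuple E -> G) :=
  forall v i a x y,
    g (tset v i (a *: x + y)) = a *: g (tset v i x) + g (tset v i y).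

Section FreeLift.
Variables (R : realType) (K : choiceType) (G : lmodType R) (g : K -> G).

Lemma fglift_add : {morph fglift g : x y / x + y}.
Proof.
move=> x y; have := lift_is_additive g; rewrite /additive => h.
have hN z : fglift g (- z) = - fglift g z.
  have h0 : fglift g 0 = 0 by have := h 0 0; rewrite !subrr.
  by have := h 0 z; rewrite !sub0r h0 sub0r.
by rewrite -{1}[y]opprK h hN opprK.
Qed.

Lemma fglift_sum (I : Type) (r : seq I) (F : I -> {freeg K / R}) :
  fglift g (\sum_(i <- r) F i) = \sum_(i <- r) fglift g (F i).
Proof.
apply: big_morph; first exact: fglift_add.
by apply: (addrI (fglift g 0)); rewrite -fglift_add !addr0.
Qed.

Lemma fglift_sumE D :
  fglift g D = \sum_(v <- dom D) coeff v D *: g v.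
Proof.
rewrite -{1}[D]freeg_sumE fglift_sum.
by apply: eq_bigr => v _; rewrite liftU.
Qed.

Lemma fgscale_sumE a (D : {freeg K / R}) :
  a *: D = \sum_(v <- dom D) << (a * coeff v D) *g v >>.
Proof. by []. Qed.

Lemma fglift_linear : linear (fglift g).
Proof.
move=> a x y; rewrite fglift_add; congr (_ + _).
rewrite [fglift g x]fglift_sumE fgscale_sumE fglift_sum scaler_sumr.
by apply: eq_bigr => v _; rewrite liftU scalerA.
Qed.

End FreeLift.

Section TensorPower.
Variables (R : realType) (E : lmodType R).

Section FixedDegree.
Variable k : nat.

Let free := {freeg (k.-tuple E) / R}.

Inductive tensor_rel : free -> Prop :=
| tensor_rel0 : tensor_rel 0
| tensor_relD a D D' :
    tensor_rel D -> tensor_rel D' -> tensor_rel (a *: D + D')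
| tensor_rel_multilinear v i a x y :
    tensor_rel (<< tset v i (a *: x + y) >> - a *: << tset v i x >>
                - << tset v i y >>).

Definition tensor_relb : pred free := fun D => `[< tensor_rel D >].

Lemma tensor_relb_zmod : zmod_closed tensor_relb.
Proof.
split=> [|x y /asboolP hx /asboolP hy]; first exact/asboolP/tensor_rel0.
by apply/asboolP; rewrite -scaleN1r addrC; exact: tensor_relD.
Qed.

HB.instance Definition _ := GRing.isZmodClosed.Build free tensor_relb
  tensor_relb_zmod.

Definition tensor_ideal : zmodClosed free :=
  GRing.ZmodClosed.clone free tensor_relb _.

Definition tpow : Type := {ideal_quot tensor_ideal}.

HB.instance Definition _ := GRing.Zmodule.on tpow.
HB.instance Definition _ := Quotient.on tpow.

Lemma pi_tpowP (x y : free) :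
  (\pi_tpow x = \pi_tpow y) <-> tensor_rel (x - y).
Proof.
split=> [/eqP|h]; last apply/eqP; rewrite /tpow -Quotient.idealrBE.
- by move=> /asboolP.
- exact/asboolP.
Qed.

Lemma tpow_piD (x y : free) : \pi_tpow (x + y) = \pi_tpow x + \pi_tpow y.
Proof. exact: Quotient.pi_add. Qed.

Definition tscale (a : R) (x : tpow) : tpow := \pi_tpow (a *: repr x).

Lemma pi_tscale a (x : free) : tscale a (\pi_tpow x) = \pi_tpow (a *: x).
Proof.
apply/pi_tpowP; rewrite -scalerBr -[_ *: _]addr0; apply: tensor_relD.
  by apply/pi_tpowP; rewrite reprK.
exact: tensor_rel0.
Qed.

Lemma tscaleA a b x : tscale a (tscale b x) = tscale (a * b) x.
Proof.
by rewrite -[x]reprK [tscale b _]pi_tscale !pi_tscale scalerA.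
Qed.

Lemma tscale1 : left_id 1 tscale.
Proof. by move=> x; rewrite -[x]reprK pi_tscale scale1r. Qed.

Lemma tscaleDr : right_distributive tscale +%R.
Proof.
by move=> a x y; rewrite -[x]reprK -[y]reprK -tpow_piD !pi_tscale -tpow_piD
  scalerDr.
Qed.

Lemma tscaleDl x : {morph tscale^~ x : a b / a + b}.
Proof. by move=> a b; rewrite -[x]reprK !pi_tscale -tpow_piD scalerDl. Qed.

HB.instance Definition _ := GRing.Zmodule_isLmodule.Build R tpow
  tscaleA tscale1 tscaleDr tscaleDl.

(** [pure v] is v_1 ⊗ ... ⊗ v_k *)
Definition pure (v : k.-tuple E) : tpow := \pi_tpow << v >>.

Lemma pure_multilinear : multilinear pure.
Proof.
move=> v i a x y; have -> : a *: pure (tset v i x) =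
  \pi_tpow (a *: << tset v i x >>) by exact: pi_tscale.
rewrite -tpow_piD; apply/pi_tpowP; rewrite opprD addrA.
exact: tensor_rel_multilinear.
Qed.

Definition tlift (G : lmodType R) (g : k.-tuple E -> G) (t : tpow) : G :=
  fglift g (repr t).

Section Lift.
Variables (G : lmodType R) (g : k.-tuple E -> G).
Hypothesis gM : multilinear g.

Let gL := fglift_linear g.

Lemma fglift_tensor_rel D : tensor_rel D -> fglift g D = 0.
Proof.
elim=> [|a D1 D2 _ h1 _ h2|v i a x y].
- by have := gL (-1) 0 0; rewrite scaler0 addr0 scaleN1r addNr.
- by rewrite gL h1 h2 scaler0 addr0.
rewrite -addrA -opprD addrC -scaleN1r gL gL !liftU !scale1r gM scaleN1r.
by rewrite addNr.
Qed.

Lemma tlift_pi D : tlift g (\pi_tpow D) = fglift g D.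
Proof.
apply/eqP; rewrite -subr_eq0 -scaleN1r addrC -gL scaleN1r addrC.
by apply/eqP/fglift_tensor_rel/pi_tpowP; rewrite reprK.
Qed.

Lemma tlift_linear : linear (tlift g).
Proof.
move=> a x y; rewrite -[x]reprK -[y]reprK.
have -> : a *: \pi_tpow (repr x) = \pi_tpow (a *: repr x) by exact: pi_tscale.
by rewrite -tpow_piD !tlift_pi gL.
Qed.

Lemma tlift_pure v : tlift g (pure v) = g v.
Proof. by rewrite tlift_pi liftU scale1r. Qed.

End Lift.

Lemma tpow_sumE (t : tpow) :
  t = \sum_(v <- dom (repr t)) coeff v (repr t) *: pure v.
Proof.
rewrite -{1}[t]reprK -{1}[repr t]freeg_sumE.
rewrite (big_morph \pi_tpow tpow_piD (_ : _ = 0)); last first.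
  by apply: (addrI (\pi_tpow 0)); rewrite -tpow_piD !addr0.
apply: eq_bigr => v _; rewrite [RHS]pi_tscale; congr (\pi_tpow _).
by apply/eqP/freeg_eqP => z; rewrite coeffZ !coeffU mul1r.
Qed.

Lemma tpow_eq_linear (G : lmodType R) (g h : {linear tpow -> G}) :
  (forall v, g (pure v) = h (pure v)) -> g =1 h.
Proof.
move=> gh t; rewrite [t]tpow_sumE !linear_sum.
by apply: eq_bigr => v _; rewrite !linearZ /= gh.
Qed.

End FixedDegree.

(** The tensor product E^{⊗p} x E^{⊗q} -> E^{⊗(p+q)} *)
Definition tmul p q (a : tpow p) (b : tpow q) : tpow (p + q) :=
  tlift (fun u => tlift (fun w => pure (cat_tuple u w)) b) a.

Lemma tset_catl p q (u : p.-tuple E) (w : q.-tuple E) i x :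
  cat_tuple (tset u i x) w = tset (cat_tuple u w) (lshift q i) x.
Proof.
apply/eq_from_tnth => j; rewrite tnth_mktuple; case: (split_ordP j) => l ->.
  by rewrite !tnth_lshift tnth_mktuple (inj_eq (@lshift_inj _ _)).
by rewrite !tnth_rshift eq_rlshift.
Qed.

Lemma tset_catr p q (u : p.-tuple E) (w : q.-tuple E) i x :
  cat_tuple u (tset w i x) = tset (cat_tuple u w) (rshift p i) x.
Proof.
apply/eq_from_tnth => j; rewrite tnth_mktuple; case: (split_ordP j) => l ->.
  by rewrite !tnth_lshift eq_lrshift.
by rewrite !tnth_rshift tnth_mktuple (inj_eq (@rshift_inj _ _)).
Qed.

Lemma cat_multilinearr p q (u : p.-tuple E) :
  multilinear (fun w : q.-tuple E => pure (cat_tuple u w)).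
Proof. by move=> w i a x y; rewrite !tset_catr pure_multilinear. Qed.

Lemma cat_multilinearl p q (b : tpow q) : multilinear
  (fun u : p.-tuple E => tlift (fun w : q.-tuple E => pure (cat_tuple u w)) b).
Proof.
move=> u i a x y; rewrite /tlift !fglift_sumE scaler_sumr -big_split /=.
apply: eq_bigr => w _; rewrite !tset_catl pure_multilinear scalerDr !scalerA.
by rewrite [_ * a]mulrC.
Qed.

Lemma tmul_pure p q (u : p.-tuple E) (w : q.-tuple E) :
  tmul (pure u) (pure w) = pure (cat_tuple u w).
Proof.
rewrite /tmul tlift_pure; last exact: cat_multilinearl.
by rewrite tlift_pure //; exact: cat_multilinearr.
Qed.

Lemma tmul_linearl p q (b : tpow q) : linear (fun a : tpow p => tmul a b).
Proof. exact/tlift_linear/cat_multilinearl. Qed.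

Lemma tmul_linearr p q (a : tpow p) : linear (@tmul p q a).
Proof.
move=> c x y; rewrite /tmul /tlift !fglift_sumE scaler_sumr -big_split /=.
apply: eq_bigr => u _; rewrite -!/(tlift _ _) tlift_linear.
  by rewrite scalerDr !scalerA [_ * c]mulrC.
exact: cat_multilinearr.
Qed.

(** w^{⊗j} *)
Definition tpower j (w : E) : tpow j := pure (nseq_tuple j w).

(** E^{⊗0} is the line spanned by the empty tensor, identified with 1. *)
Lemma tpow0E (t : tpow 0) :
  t = tlift (fun=> 1 : R^o) t *: pure [tuple].
Proof.
rewrite {1}[t]tpow_sumE /tlift fglift_sumE scaler_suml.
by apply: eq_bigr => v _; rewrite tuple0 [_ *: 1]mulr1.
Qed.

End TensorPower.

Section Lip.
Variable R : realType.

(** The integer n with 0 < g - n <= 1, for g > 0. *)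
Definition lfloor (g : R) : nat := `|Num.ceil g - 1|%N.

Lemma lfloorP (g : R) : 0 < g -> 0 < g - (lfloor g)%:R <= 1.
Proof.
move=> g0; have h : 0 <= Num.ceil g - 1.
  by rewrite subr_ge0 -gtz0_ge1 real_ceil_gt_int ?num_real.
have /andP[h1 h2] := real_ceil_itv (num_real g).
rewrite /lfloor natr_absz ger0_norm // subr_gt0 h1 /=.
by rewrite lerBlDl -intrD1 subrK.
Qed.

Definition is_norm (V : lmodType R) (N : V -> R) :=
  [/\ forall x y, N (x + y) <= N x + N y,
      forall a x, N (a *: x) = `|a| * N x &
      forall x, N x = 0 -> x = 0].

Variables (E F : normedModType R).
Implicit Types (N : forall k, tpow E k -> R) (U : set E).

(** Norms on E^{⊗k} for k <= n. E^{⊗0} and E^{⊗1} carry the norms of the field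
    and of E. *)
Definition tensor_norms n N :=
  [/\ forall k, (k <= n)%N -> is_norm (N k),
      N 0 (pure [tuple]) = 1 &
      (1 <= n)%N -> forall v : E, N 1 (pure [tuple v]) = `|v|].

Definition projective n N :=
  forall p q (a : tpow E p) (b : tpow E q),
    (1 <= p)%N -> (1 <= q)%N -> (p + q <= n)%N ->
    N (p + q)%N (tmul a b) <= N p a * N q b.

(** Only the components f 0, ..., f n on U matter for a map of order n, so
    passing to a lower degree is automatically a truncation. The value of the
    underlying map at x is [f 0 x (pure [tuple])]. *)
Definition lip_family := forall k, E -> {linear tpow E k -> F}.
Implicit Type f : lip_family.

Definition symmetric_lin k (l : tpow E k -> F) :=
  forall (v : k.-tuple E) (s : 'S_k),
    l (pure [tuple tnth v (s i) | i < k]) = l (pure v).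

(** Here j stands for j - k in the usual formula. *)
Definition lip_rem n f k (x y : E) (t : tpow E k) : F :=
  f k x t - \sum_(j < (n - k).+1)
    f (k + j)%N y ((j`!%:R)^-1 *: tmul t (tpower j (x - y))).

Definition lip_bound N (g : R) U f (M : R) :=
  forall k, (k <= lfloor g)%N -> forall x y, U x -> U y ->
  forall v : k.-tuple E,
    `|f k x (pure v)| <= M * N k (pure v) /\
    `|lip_rem (lfloor g) f x y (pure v)|
      <= M * `|x - y| `^ (g - k%:R) * N k (pure v).

Definition is_lip N (g : R) U f :=
  (forall k x, (1 <= k <= lfloor g)%N -> U x -> symmetric_lin (f k x)) /\
  exists M, lip_bound N g U f M.

(** M >= 0 only matters when U is empty. *)
Definition lip_norm N (g : R) U f : R :=
  inf [set M | 0 <= M /\ lip_bound N g U f M].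

Lemma is_norm_ge0 (V : lmodType R) (N : V -> R) x : is_norm N -> 0 <= N x.
Proof.
case=> tri hom _; have h0 : N 0 = 0 by rewrite -(scale0r x) hom normr0 mul0r.
have := tri x (- x); rewrite subrr h0 -scaleN1r hom normrN1 mul1r.
by rewrite -mulr2n pmulrn_lge0.
Qed.

Lemma lip_norm_min N g U f : tensor_norms (lfloor g) N -> is_lip N g U f ->
  [/\ 0 <= lip_norm N g U f,
      lip_bound N g U f (lip_norm N g U f) &
      forall M, 0 <= M -> lip_bound N g U f M -> lip_norm N g U f <= M].
Proof.
move=> [Nn _ _] [_ [M hM]]; rewrite /lip_norm; set S := [set M | _].
have lS : has_lbound S by exists 0 => x [].
have bndW m1 m2 : m1 <= m2 -> lip_bound N g U f m1 -> lip_bound N g U f m2.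
  move=> m12 h k kn x y Ux Uy v; have [h1 h2] := h k kn x y Ux Uy v.
  have N0 := is_norm_ge0 (pure v) (Nn k kn).
  split; first by rewrite (le_trans h1)// ler_wpM2r.
  by rewrite (le_trans h2)// ler_wpM2r// ler_wpM2r// powR_ge0.
have S0 : S !=set0.
  exists (Num.max 0 M); split; first by rewrite le_max lexx.
  by apply: bndW hM; rewrite le_max lexx orbT.
have infle c d : 0 <= c -> (forall m, S m -> d <= m * c) -> d <= inf S * c.
  rewrite le_eqVlt => /predU1P[<-|c0] h.
    by have [m Sm] := S0; have := h m Sm; rewrite !mulr0.
  rewrite -ler_pdivrMr//; apply: lb_le_inf => // m Sm.
  by rewrite ler_pdivrMr//; exact: h.
split; first by apply: lb_le_inf => // m [].
  move=> k kn x y Ux Uy v; have N0 := is_norm_ge0 (pure v) (Nn k kn).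
  split; first by apply: infle => // m [_ /(_ k kn x y Ux Uy v)[]].
  rewrite -mulrA; apply: infle; first by rewrite mulr_ge0// powR_ge0.
  by move=> m [_ /(_ k kn x y Ux Uy v)[_]]; rewrite mulrA.
by move=> m m0 hm; apply: ge_inf.
Qed.

End Lip.

(* Main.v *)
Require Import Defs.
From HB Require Import structures.
From mathcomp Require Import all_boot all_order all_algebra.
From mathcomp Require Import all_classical all_reals all_analysis.
Import Order.TTheory GRing.Theory Num.Theory.
Import numFieldNormedType.Exports.
Local Open Scope classical_set_scope.
Local Open Scope ring_scope.

(** Write [n' <= n] for the integer parts of [g' < g]. The Taylor terms of order
    [j] are bounded by [M |x - y|^j] thanks to the projective property. For
    [|x - y| <= 1], the remainder of degree [g'] is the remainder of degree [g]
    plus the Taylor terms of order [j > n' - k], and all of these are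
    [O(|x - y|^(g' - k))] because [j >= g' - k]. For [|x - y| > 1], it is the
    difference of [f k x] and the Taylor terms of order [j <= n' - k], which are
    [O(|x - y|^(g' - k))] because [j <= g' - k]. *)

(** Tensor powers of provably equal degrees, such as [k + 0] and [k], can be distinct types;
    comparing norms of pure tensors via their underlying sequences avoids casts. *)
Lemma norm_pure_cast (R : realType) (E : lmodType R)
    (N : forall k, tpow E k -> R) m n (u : m.-tuple E) (v : n.-tuple E) :
  m = n -> tval u = tval v -> N m (pure u) = N n (pure v).
Proof. by move=> mn; case: n / mn v => v uv; rewrite (val_inj uv). Qed.

Lemma ler_lfloor (R : realType) (g g' : R) :
  0 < g -> 0 < g' -> g' <= g -> (lfloor g' <= lfloor g)%N.
Proof.
move=> /lfloorP/andP[_ h1] /lfloorP/andP[h2 _] gg.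
rewrite subr_gt0 in h2; rewrite -ltnS -(ltr_nat R); apply: lt_le_trans h2 _.
by apply: (le_trans gg); rewrite -natr1 -lerBlDl.
Qed.

Section Taylor.
Context {R : realType} {E F : normedModType R} {N : forall k, tpow E k -> R}.

Lemma le_tensor_norms m n : (m <= n)%N -> tensor_norms n N -> tensor_norms m N.
Proof.
move=> mn [Nn N0 N1]; split=> // [k km|m1]; first exact/Nn/(leq_trans km).
exact/N1/(leq_trans m1).
Qed.

Lemma norm_tpower_le n (w : E) j : tensor_norms n N -> projective n N ->
  (j <= n)%N -> N j (tpower j w) <= `|w| ^+ j.
Proof.
move=> [Nn N0 N1] Np; elim: j => [_|j IH jn].
  by rewrite expr0 -N0 /tpower (tuple0 (nseq_tuple 0 w)).
have n1 : (1 <= n)%N by exact: leq_trans jn.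
(* Degree 1 is settled by the normalization on E, because [projective] only speaks of factors of
   positive degree. *)
case: j IH jn => [_ _|j IH jn].
  rewrite expr1 -(N1 n1) le_eqVlt; apply/orP; left.
  by apply/eqP; exact: norm_pure_cast.
have -> : N j.+2 (tpower j.+2 w) =
    N (1 + j.+1)%N (tmul (pure [tuple w]) (tpower j.+1 w)).
  by rewrite tmul_pure; exact: norm_pure_cast.
apply: le_trans (Np 1%N j.+1 _ _ _ _ jn) _ => //.
rewrite N1// exprS ler_wpM2l//; exact/IH/ltnW.
Qed.

Lemma norm_tmul_tpower_le n k (v : k.-tuple E) j (w : E) :
  tensor_norms n N -> projective n N -> (k + j <= n)%N ->
  N (k + j)%N (tmul (pure v) (tpower j w)) <= N k (pure v) * `|w| ^+ j.
Proof.
move=> Nt Np kjn; have [Nn N0 _] := Nt.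
have jn : (j <= n)%N by exact: leq_trans (leq_addl _ _) kjn.
have kn : (k <= n)%N by exact: leq_trans (leq_addr _ _) kjn.
(* If [k] or [j] is 0, one factor is the empty tensor, of norm 1, and [projective] does not
   apply. *)
have [k0|k0] := posnP k.
  subst k; rewrite (tuple0 v) N0 mul1r tmul_pure.
  apply: le_trans _ (norm_tpower_le _ w j Nt Np jn).
  by rewrite le_eqVlt; apply/orP; left; apply/eqP; exact: norm_pure_cast.
have [j0|j0] := posnP j.
  subst j; rewrite expr0 mulr1 tmul_pure le_eqVlt; apply/orP; left; apply/eqP.
  by apply: norm_pure_cast; rewrite /= ?addn0 ?cats0.
apply: le_trans (Np _ _ _ _ k0 j0 kjn) _.
by rewrite ler_wpM2l ?(norm_tpower_le _ _ _ Nt)// is_norm_ge0//; exact: Nn.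
Qed.

(** Indexing by [nat] rather than by ordinals lets the Taylor sum be split at any order. *)
Definition taylor_term (f : lip_family E F) k (y : E) (t : tpow E k) (w : E) j
    : F :=
  f (k + j)%N y ((j`!%:R)^-1 *: tmul t (tpower j w)).

Lemma lip_remE n (f : lip_family E F) k x y (t : tpow E k) :
  lip_rem n f x y t =
  f k x t - \sum_(0 <= j < (n - k).+1) taylor_term f k y t (x - y) j.
Proof. by rewrite big_mkord. Qed.

Lemma lip_rem_truncate m n (f : lip_family E F) k x y (t : tpow E k) :
  (m <= n)%N ->
  lip_rem m f x y t = lip_rem n f x y t +
    \sum_((m - k).+1 <= j < (n - k).+1) taylor_term f k y t (x - y) j.
Proof.
move=> mn; rewrite !lip_remE.
rewrite (@big_cat_nat _ _ _ (m - k).+1 0 (n - k).+1)//=; last first.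
  by rewrite ltnS leq_sub2r.
by rewrite opprD addrA subrK.
Qed.

(** A bound on pure tensors suffices, since the product of [pure v] with a tensor power of [w] is
    again pure. The factor [1 / j!] is at most 1 and is dropped. *)
Lemma norm_taylor_term_le n (f : lip_family E F) M k (v : k.-tuple E)
    (y w : E) j :
  tensor_norms n N -> projective n N -> 0 <= M -> (k + j <= n)%N ->
  (forall u : (k + j).-tuple E,
    `|f (k + j)%N y (pure u)| <= M * N (k + j)%N (pure u)) ->
  `|taylor_term f k y (pure v) w j| <= M * `|w| ^+ j * N k (pure v).
Proof.
move=> Nt Np M0 kjn fM; rewrite /taylor_term linearZ normrZ.
rewrite ger0_norm ?invr_ge0//.
have fle : `|f (k + j)%N y (tmul (pure v) (tpower j w))|
    <= M * `|w| ^+ j * N k (pure v).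
  rewrite {1}/tpower tmul_pure; apply: le_trans (fM _) _.
  rewrite -tmul_pure -mulrA ler_wpM2l// mulrC.
  exact: norm_tmul_tpower_le Nt Np kjn.
apply: le_trans fle; apply: ler_piMl => //.
by rewrite invf_le1 ?ltr0n ?fact_gt0// ler1n fact_gt0.
Qed.

Lemma norm_sum_nat_le m n (T : nat -> F) (A : R) : 0 <= A ->
  (forall j, (m <= j < n)%N -> `|T j| <= A) ->
  `|\sum_(m <= j < n) T j| <= n%:R * A.
Proof.
move=> A0 TA; apply: le_trans (ler_norm_sum _ _ _) _.
apply: (@le_trans _ _ (\sum_(m <= j < n) A)).
  rewrite big_nat_cond [leRHS]big_nat_cond ler_sum// => j.
  by rewrite andbT => /TA.
by rewrite sumr_const_nat -[leLHS]mulr_natl ler_wpM2r// ler_nat leq_subr.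
Qed.

Lemma powR_le_small (r a b : R) : 0 <= r <= 1 -> 0 < b -> b <= a ->
  r `^ a <= r `^ b.
Proof.
(* At [r = 0] both powers vanish, the exponents being nonzero. *)
move=> /andP[r0 r1] b0 ba; move: r0; rewrite le_eqVlt => /predU1P[<-|r0].
  by rewrite !powR0 ?gt_eqF// (lt_le_trans b0).
by rewrite ger_powR// r0.
Qed.

Lemma lip_bound_lower {g g' : R} {U : set E} {f : lip_family E F} {M : R} :
  0 < g' -> g' < g -> tensor_norms (lfloor g) N -> projective (lfloor g) N ->
  0 <= M -> lip_bound N g U f M ->
  lip_bound N g' U f ((lfloor g).+2%:R * M).
Proof.
move=> g'0 g'g Nt Np M0 fM k kn' x y Ux Uy v.
have g0 : 0 < g by exact: lt_trans g'g.
have n'n := ler_lfloor R g g' g0 g'0 (ltW g'g).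
have /andP[n'lt n'ge] := lfloorP g'0.
have kn := leq_trans kn' n'n.
have [fxM remM] := fM k kn x y Ux Uy v.
have [Nn _ _] := Nt; have Nv0 := is_norm_ge0 (pure v) (Nn k kn).
have termM j : (k + j <= lfloor g)%N ->
    `|taylor_term f k y (pure v) (x - y) j| <= M * `|x - y| ^+ j * N k (pure v).
  move=> kjn; apply: (norm_taylor_term_le _ _ _ _ _ _ _ _ Nt Np M0 kjn) => u.
  by have [] := fM _ kjn y y Uy Uy u.
have g'k : 0 < g' - k%:R.
  rewrite subr_gt0; apply: (@le_lt_trans _ _ (lfloor g')%:R).
    by rewrite ler_nat.
  by rewrite -subr_gt0.
split.
  apply: le_trans fxM _; rewrite ler_wpM2r// ler_peMl//.
  by rewrite ler1n.
set r := `|x - y| in remM termM *.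
set A := M * r `^ (g' - k%:R) * N k (pure v).
have A0 : 0 <= A by rewrite !mulr_ge0// powR_ge0.
(* In both cases below, one [A] pays for the leading term ([f k x] or the old remainder), and the
   other [(lfloor g).+1] copies pay for the Taylor terms, one each. *)
have -> : (lfloor g).+2%:R * M * r `^ (g' - k%:R) * N k (pure v)
    = A + (lfloor g).+1%:R * A.
  by rewrite -{1}[A]mul1r -mulrDl nat1r /A !mulrA.
have leA (c : R) : c <= r `^ (g' - k%:R) -> M * c * N k (pure v) <= A.
  by move=> ?; rewrite ler_wpM2r// ler_wpM2l.
have powA a : r ^+ a = r `^ a%:R by rewrite powR_mulrn ?normr_ge0.
have [r1|r1] := leP r 1.
  rewrite (lip_rem_truncate _ _ _ _ _ _ _ n'n).
  apply: le_trans (ler_normD _ _) _; apply: lerD.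
    apply: le_trans remM _; apply: leA; apply: powR_le_small => //.
      by rewrite normr_ge0.
    by rewrite lerD2r ltW.
  apply: (@le_trans _ _ ((lfloor g - k).+1%:R * A)); last first.
    by rewrite ler_wpM2r// ler_nat ltnS leq_subr.
  apply: norm_sum_nat_le => // j /andP[mj jn].
  apply: le_trans (termM j _) _; first by rewrite -leq_subRL.
  apply: leA; rewrite powA; apply: powR_le_small => //.
    by rewrite normr_ge0.
  (* The discarded orders satisfy [k + j >= lfloor g' + 1 >= g'], with equality possible when [g']
     is an integer. *)
  rewrite lerBlDr -natrD; apply: (@le_trans _ _ (lfloor g').+1%:R).
    by rewrite -natr1 -lerBlDl.
  by rewrite ler_nat addnC -leq_subLR subSn.
rewrite lip_remE; apply: le_trans (ler_normB _ _) _; apply: lerD.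
  (* The bound on [f k x] has no power of [r], but [1 <= r ^ (g' - k)] since [r > 1]. *)
  apply: le_trans fxM _; rewrite -[M in leLHS]mulr1; apply: leA.
  by rewrite -[leLHS](powRr0 r); apply: ler_powR; exact: ltW.
apply: (@le_trans _ _ ((lfloor g' - k).+1%:R * A)); last first.
  by rewrite ler_wpM2r// ler_nat ltnS (leq_trans (leq_subr _ _)).
apply: norm_sum_nat_le => // j /= jn.
have kjn' : (k + j <= lfloor g')%N by rewrite -leq_subRL.
apply: le_trans (termM j (leq_trans kjn' n'n)) _; apply: leA.
rewrite powA; apply: ler_powR; apply: ltW => //.
(* The retained orders satisfy [k + j <= lfloor g' < g']. *)
rewrite ltrBrDr -natrD addnC; apply: (@le_lt_trans _ _ (lfloor g')%:R).
  by rewrite ler_nat.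
by rewrite -subr_gt0.
Qed.

End Taylor.

Theorem theorem1p18 (R : realType) (g g' : R) (g0 : 0 < g) (g'0 : 0 < g')
    (g'g : g' < g) :
  exists M : R, forall (E F : normedModType R) (U : set E)
      (N : forall k, tpow E k -> R),
    tensor_norms (lfloor g) N -> projective (lfloor g) N ->
    forall f : lip_family E F, is_lip N g U f ->
      is_lip N g' U f /\ lip_norm N g' U f <= M * lip_norm N g U f.
Proof.
exists (lfloor g).+2%:R => E F U N Nt Np f fL.
have n'n := ler_lfloor R g g' g0 g'0 (ltW g'g).
(* The infimum is attained, so the Lipschitz norm itself serves as the constant to be transferred to
   degree [g']. *)
have [M0 fM _] := lip_norm_min Nt fL.
have fM' := lip_bound_lower g'0 g'g Nt Np M0 fM.
have fL' : is_lip N g' U f.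
  split; last by exists ((lfloor g).+2%:R * lip_norm N g U f).
  move=> k x /andP[k1 kn'] Ux; apply: (fL.1 k x) => //.
  by rewrite k1 (leq_trans kn').
have [_ _ min'] := lip_norm_min (le_tensor_norms _ _ n'n Nt) fL'.
by split=> //; apply: min' => //; rewrite mulr_ge0.
Qed.
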